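(* Let $w$ be the standard Sturmian word of slope $\alpha$, with $\alpha$ irrational and $0<\alpha<1/2$, and let $[0;d_0+1,d_1,\ldots]$, with $d_0>0$, be the continued fraction expansion of $\alpha$. For every $n\ge 0$ let $k_n=K[1,d_0,\ldots,d_{n-1},d_n-1]$ (so $k_0=K[1,d_0-1]$). Then $$\mathit{oc}(w)=\prod_{n\ge 0}1^{k_n}0^{k_n},$$ that is, $\mathit{oc}(w)$ is the infinite concatenation, for $n=0,1,2,\ldots$, of $k_n$ ones followed by $k_n$ zeros.
   Context: Let $\Sigma=\{a,b\}$. Given $\alpha=[0;d_0+1,d_1,d_2,\ldots]$ irrational, define $s_{-1}=b$, $s_0=a$, $s_{n+1}=s_n^{d_n}s_{n-1}$ for $n\ge 0$. The sequence $(s_n)$ converges to an infinite word, called the standard Sturmian word of slope $\alpha$. The continuants of an integer sequence $(a_n)_{n\ge 0}$ are defined by $K[\,]=1$, $K[a_0]=a_0$, and $K[a_0,\ldots,a_n]=a_nK[a_0,\ldots,a_{n-1}]+K[a_0,\ldots,a_{n-2}]$ for $n\ge 1$. A finite word $w$ is closed if it is empty or has a factor $v\neq w$ (possibly empty) occurring exactly twice in $w$, once as a prefix and once as a suffix (the two occurrences may overlap; the empty word has $|w|+1$ occurrences in $w$). A word that is not closed is open. For an infinite word $w$, $\mathit{oc}(w)$ is the sequence, indexed by $n\ge 1$, whose $n$-th element is $1$ if the prefix of length $n$ of $w$ is closed, and $0$ otherwise. *)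

(* Defs.v *)
From mathcomp Require Import all_boot all_order all_algebra.
From mathcomp Require Import all_classical all_reals all_analysis.
Import numFieldNormedType.Exports.

Set Implicit Arguments.
Unset Strict Implicit.
Unset Printing Implicit Defensive.

Import Order.TTheory GRing.Theory Num.Theory.

Local Open Scope ring_scope.
Local Open Scope classical_set_scope.

(* [a_0; a_1, ..., a_m] for the list a_0, a_1, ..., a_m *)
Fixpoint cfrac (R : realType) (s : seq R) : R :=
  match s with
  | [::] => 0
  | [:: x] => x
  | x :: s' => x + 1 / cfrac s'
  end.

(* alpha = [q_0; q_1, q_2, ...], an infinite simple continued fraction *)
Definition is_contfrac (R : realType) (q : nat -> nat) (alpha : R) : Prop :=
  (forall n, (0 < n)%N -> (0 < q n)%N) /\
  (fun n => cfrac (mkseq (fun i => (q i)%:R : R) n.+1)) @ \oo --> alpha.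

Definition slope_quotients (d : nat -> nat) (n : nat) : nat :=
  match n with
  | 0 => 0
  | 1 => (d 0).+1
  | m.+1 => d m
  end.

Local Close Scope ring_scope.
Local Open Scope nat_scope.

(* Infinite words are functions from nat; the word x is the limit of the finite
   words s_n when each letter of x is eventually the letter of s_n at the same
   position (so the lengths of the s_n tend to infinity). *)
Definition word_lim (T : Type) (s : nat -> seq T) (x : nat -> T) : Prop :=
  forall i, exists N, forall n, N <= n -> onth (s n) i = Some (x i).

Definition word_pow (T : Type) (u : seq T) (n : nat) : seq T :=
  flatten (nseq n u).

Definition is_infinite_product (T : Type) (u : nat -> seq T) (x : nat -> T) :
    Prop :=
  word_lim (fun n => flatten (mkseq u n)) x.

(* The alphabet {a, b} *)
Notation letter := bool (only parsing).
Definition letter_a : letter := false.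
Definition letter_b : letter := true.

(* Indices are shifted by one: std_shift d n is s_{n-1}. *)
Fixpoint std_shift (d : nat -> nat) (n : nat) : seq letter :=
  match n with
  | 0 => [:: letter_b]
  | n1.+1 =>
    match n1 with
    | 0 => [:: letter_a]
    | n2.+1 => word_pow (std_shift d n1) (d n2) ++ std_shift d n2
    end
  end.

Definition std (d : nat -> nat) (n : nat) : seq letter := std_shift d n.+1.

(* The recurrence for continuants acts on the last entry, hence the reversal. *)
Fixpoint continuant_rev (s : seq nat) : nat :=
  match s with
  | [::] => 1
  | x :: s1 =>
    match s1 with
    | [::] => x
    | _ :: s2 => x * continuant_rev s1 + continuant_rev s2
    end
  end.

Definition continuant (s : seq nat) : nat := continuant_rev (rev s).

(* Truncated subtraction is harmless here: the d_n are positive. *)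
Definition kseq (d : nat -> nat) (n : nat) : nat :=
  continuant (1 :: rcons (mkseq d n) (d n - 1)).

(* The empty word occurs at all size w + 1 positions. *)
Definition occurrences (T : eqType) (v w : seq T) : nat :=
  count (fun i => prefix v (drop i w)) (iota 0 (size w).+1).

(* As v <> w, its occurrences as a prefix and as a suffix are at different
   positions, so they are the two that are counted. *)
Definition closed_word (T : eqType) (w : seq T) : Prop :=
  w = [::] \/
  exists v : seq T,
    [/\ v <> w, prefix v w, suffix v w & occurrences v w = 2].

(* Entry number n + 1 of the sequence oc(x), which is indexed from 1 *)
Definition oc (T : eqType) (x : nat -> T) (n : nat) : nat :=
  if `[< closed_word (mkseq x n.+1) >] then 1 else 0.

(* Main.v *)
(** Let [q n] be the length of [s_n]. The words [s_{n+1} s_n] and [s_n s_{n+1}]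
    differ exactly by an exchange of their last two letters, so [w] agrees with
    its shift by [q n] on exactly the first [q n.+1 - 2] letters, and by
    induction it agrees with a shift by [0 < i < q n] on at most [q n - 2]
    letters. A prefix of length [m] is closed iff it has a period [p] such that
    its border of length [m - p] does not occur at a position [0 < i < p]; the
    above shows that this happens with [p = q n] when
    [2 * q n - 2 < m <= q n + q n.+1 - 2], and never when
    [q n + q n.+1 - 2 < m <= 2 * q n.+1 - 2]. Both intervals have length
    [k_n = q n.+1 - q n]. *)

Require Import Defs.
From mathcomp Require Import all_boot all_order all_algebra.
From mathcomp Require Import all_classical all_reals all_analysis.
From mathcomp Require Import zify.
Import numFieldNormedType.Exports.
Import Order.TTheory GRing.Theory Num.Theory.

Set Implicit Arguments.
Unset Strict Implicit.
Unset Printing Implicit Defensive.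

(** * Closed prefixes in terms of shifts of the infinite word *)

Definition agree (T : Type) (w : nat -> T) (l i : nat) : Prop :=
  forall x, x < l -> w (x + i) = w x.

Lemma agree_leq (T : Type) (w : nat -> T) (l l' i : nat) :
  l' <= l -> agree w l i -> agree w l' i.
Proof. by move=> le_l ag x lt_x; apply: ag; apply: leq_trans le_l. Qed.

Lemma drop_mkseq (T : Type) (w : nat -> T) (m i : nat) :
  drop i (mkseq w m) = mkseq (fun x => w (x + i)) (m - i).
Proof.
rewrite /mkseq -map_drop drop_iota add0n -[i in iota i]addn0 iotaDl -map_comp.
by apply: eq_map => x /=; rewrite addnC.
Qed.

Lemma prefix_mkseq (T : eqType) (u w : nat -> T) (l m : nat) :
  prefix (mkseq u l) (mkseq w m) <-> l <= m /\ (forall x, x < l -> u x = w x).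
Proof.
rewrite prefixE size_mkseq; split=> [/eqP eq_uw | [le_lm eq_uw]].
  have le_lm : l <= m.
    have := congr1 size eq_uw; rewrite size_take !size_mkseq.
    by case: ltnP => [/ltnW //|_ ->].
  split=> // x lt_xl; rewrite -(nth_mkseq (w 0) u lt_xl) -eq_uw.
  by rewrite nth_take // nth_mkseq //; apply: leq_trans le_lm.
apply/eqP/(@eq_from_nth _ (w 0)); rewrite size_takel ?size_mkseq // => x lt_xl.
by rewrite nth_take // !nth_mkseq // ?eq_uw //; apply: leq_trans le_lm.
Qed.

Lemma prefix_drop_mkseq (T : eqType) (w : nat -> T) (l m i : nat) :
  prefix (mkseq w l) (drop i (mkseq w m)) <-> l <= m - i /\ agree w l i.
Proof.
rewrite drop_mkseq prefix_mkseq.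
by split=> -[le_l ag]; split=> // x lt_x; apply/esym/ag.
Qed.

(** Meant for [p] the position of the suffix occurrence: beyond it too few letters remain for
    another one, so only positions strictly between [0] and [p] are left to exclude. *)
Lemma count_iota_eq2 (a : pred nat) (m p : nat) :
  0 < p <= m -> a 0 -> a p -> (forall i, p < i <= m -> a i = false) ->
  count a (iota 0 m.+1) = 2 <-> (forall i, 0 < i < p -> ~~ a i).
Proof.
move=> /andP[p_gt0 le_pm] a0 ap a_gt.
have -> : m.+1 = 1 + (p.-1 + (1 + (m - p))) by lia.
rewrite !iotaD !count_cat /=.
have -> : 0 + 1 + p.-1 = p by lia.
have -> : count a (iota (p + 1) (m - p)) = 0.
  apply/eqP; rewrite -leqn0 leqNgt -has_count; apply/hasPn => i.
  by rewrite mem_iota => ?; rewrite a_gt //; lia.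
rewrite a0 ap /= !addn0 add0n; split=> [cnt i /andP[? ?]|a_mid].
  have : ~~ has a (iota 1 p.-1) by rewrite has_count; lia.
  by move/hasPn; apply; rewrite mem_iota; lia.
have : ~~ has a (iota 1 p.-1).
  by apply/hasPn => i; rewrite mem_iota => ?; apply: a_mid; lia.
by rewrite has_count; lia.
Qed.

(** Here [p] is a period, [m - p] is the length of the border [v], and [v <> w] becomes [0 < p]. The
    empty border, [p = m], occurs everywhere, so it is admissible only for [m = 1]. *)
Lemma closed_mkseqP (T : eqType) (w : nat -> T) (m : nat) : 0 < m ->
  closed_word (mkseq w m) <->
  exists p, [/\ 0 < p <= m, agree w (m - p) p &
                forall i, 0 < i < p -> ~ agree w (m - p) i].
Proof.
move=> m_gt0.
have occ p : 0 < p <= m -> agree w (m - p) p ->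
    occurrences (mkseq w (m - p)) (mkseq w m) = 2 <->
    (forall i, 0 < i < p -> ~ agree w (m - p) i).
  move=> p_bnd ag_p; rewrite /occurrences size_mkseq (@count_iota_eq2 _ _ p) //.
  - split=> no_i i i_bnd; last first.
      by apply/negP => /prefix_drop_mkseq[_]; apply: no_i.
    move=> ag; move: (no_i i i_bnd) => /negP; apply.
    by apply/prefix_drop_mkseq; split=> //; lia.
  - by apply/prefix_drop_mkseq; split; [lia | move=> x _; rewrite addn0].
  - exact/prefix_drop_mkseq.
  - by move=> i lt_pi; apply/negP => /prefix_drop_mkseq[]; lia.
split=> [[/(congr1 size)|[v [neq_v pre_v suf_v occ_v]]]|[p [p_bnd ag_p no_i]]].
- by rewrite size_mkseq /=; lia.
- have le_vm : size v <= m by rewrite -(size_mkseq w m) size_prefix.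
  have def_v : v = mkseq w (size v).
    move: pre_v; rewrite prefixE => /eqP {1}<-.
    by rewrite /mkseq -map_take take_iota (minn_idPl le_vm).
  have lt_vm : size v < m.
    rewrite ltn_neqAle le_vm andbT; apply/eqP => eq_vm.
    by apply: neq_v; rewrite def_v eq_vm.
  pose p := m - size v.
  have size_v : size v = m - p by lia.
  have p_bnd : 0 < p <= m by lia.
  rewrite def_v size_v in suf_v occ_v.
  have ag_p : agree w (m - p) p.
    move: suf_v; rewrite suffixE !size_mkseq subKn; last by case/andP: p_bnd.
    by move=> /eqP suf; apply: (proj2 (iffLR (prefix_drop_mkseq _ _ m _) _));
       rewrite suf prefix_refl.
  by exists p; split=> //; apply/occ.
right; exists (mkseq w (m - p)); split; last exact/occ.
- by move/(congr1 size); rewrite !size_mkseq; lia.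
- by rewrite prefix_mkseq; split=> //; lia.
- rewrite suffixE !size_mkseq subKn; last by case/andP: p_bnd.
  rewrite drop_mkseq; apply/eqP; apply/eq_in_map => x.
  by rewrite mem_iota; apply: ag_p.
Qed.

(** * Shifts along an increasing sequence of periods *)

Lemma agree_mul (T : Type) (w : nat -> T) (l p c x : nat) :
  agree w l p -> x + c * p < l + p -> w (x + c * p) = w x.
Proof.
move=> ag; elim: c => [|c IHc] lt_x; first by rewrite mul0n addn0.
rewrite mulSn in lt_x *; rewrite [p + _]addnC addnA ag; last lia.
by apply: IHc; lia.
Qed.

(** Induction on [n], dividing a shift [i < q n.+1] by the period [q n]. A length of [(q n.+1).-1]
    is just enough to include the mismatch position [q n.+1 - 2]. *)
Lemma agree_bound (T : Type) (w : nat -> T) (q : nat -> nat) :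
  q 0 = 1 -> (forall n, q n < q n.+1) ->
  (forall n, agree w (q n.+1 - 2) (q n)) ->
  (forall n, w (q n.+1 - 2 + q n) <> w (q n.+1 - 2)) ->
  forall n i, 0 < i < q n -> ~ agree w (q n).-1 i.
Proof.
move=> q0 q_lt ag neq; elim=> [|n IHn] i; first by rewrite q0; lia.
move=> i_bnd ag_i; have lt_q := q_lt n.
have q_gt0 : 0 < q n by case: (n) => [|k]; rewrite ?q0 //; have := q_lt k; lia.
have def_i := divn_eq i (q n); have lt_r := ltn_pmod i q_gt0.
set r := i %% q n in def_i lt_r; set c := i %/ q n in def_i.
(* Within the prefix of period [q n], a shift by [i] is a shift by [r]; if
   [r = 0], it instead reaches the mismatch at the end of that prefix. *)
have [r0|r_gt0] := posnP r.
  have c_gt0 : 0 < c by case: (posnP c) => // c0; rewrite c0 r0 in def_i; lia.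
  have def_c : c = c.-1.+1 by rewrite prednK.
  have def_i' : i = c.-1 * q n + q n.
    by rewrite def_i r0 {1}def_c mulSn addn0 addnC.
  pose x := q n.+1 - 2 - c.-1 * q n.
  apply: (neq n).
  have def_x : q n.+1 - 2 = x + c.-1 * q n by rewrite /x; lia.
  rewrite {1}def_x -addnA -def_i' ag_i; last by rewrite /x; lia.
  by rewrite def_x (agree_mul (ag n)) //; lia.
apply: (IHn r); first by rewrite r_gt0.
(* The bound is tight: [x <= q n - 2] and [i <= q n.+1 - 1] keep [x + i] inside the prefix of length
   [q n + q n.+1 - 2], which has period [q n]. *)
move=> x lt_x; rewrite -(@agree_mul _ _ _ _ c (x + r) (ag n)); last lia.
have -> : x + r + c * q n = x + i by lia.
by apply: ag_i; lia.
Qed.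

Lemma map_iota_const (T : Type) (f : nat -> T) (c : T) (m k : nat) :
  (forall i, m <= i < m + k -> f i = c) -> [seq f i | i <- iota m k] = nseq k c.
Proof.
elim: k m => //= k IHk m f_c; rewrite f_c ?IHk //; last lia.
by move=> i i_bnd; apply: f_c; lia.
Qed.

Lemma oc_mkseq (T : eqType) (w : nat -> T) (q : nat -> nat) :
  q 0 = 1 -> (forall n, q n < q n.+1) ->
  (forall n, agree w (q n.+1 - 2) (q n)) ->
  (forall n, w (q n.+1 - 2 + q n) <> w (q n.+1 - 2)) ->
  forall n,
    flatten (mkseq (fun n => nseq (q n.+1 - q n) 1 ++ nseq (q n.+1 - q n) 0) n)
    = mkseq (oc w) (2 * q n - 2).
Proof.
move=> q0 q_lt ag neq; elim=> [|n IHn]; first by rewrite q0.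
have lt_q := q_lt n; have bound := agree_bound q0 q_lt ag neq.
have q_gt0 : 0 < q n by case: (n) => [|k]; rewrite ?q0 //; have := q_lt k; lia.
rewrite mkseqS flatten_rcons {}IHn.
have -> : 2 * q n.+1 - 2 =
    2 * q n - 2 + ((q n.+1 - q n) + (q n.+1 - q n)) by lia.
rewrite /mkseq !iotaD !map_cat add0n; congr (_ ++ (_ ++ _)).
  (* Entry [i] concerns the prefix of length [i.+1]; its border of length [i.+1 - q n] lies between
     [(q n).-1], where [bound] applies, and [q n.+1 - 2]. *)
  apply/esym/map_iota_const => i i_bnd; rewrite /oc asboolT //.
  apply/closed_mkseqP => //; exists (q n); split; first lia.
    by apply: agree_leq (ag n); lia.
  move=> j j_bnd ag_j; apply: (bound n j j_bnd).
  by apply: agree_leq ag_j; lia.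
apply/esym/map_iota_const => i i_bnd; rewrite /oc asboolF //.
move=> /closed_mkseqP -/(_ isT) [p [p_bnd ag_p no_i]].
(* A longer border would force [p < q n.+1], against [bound] at [n.+1]. *)
have short : i.+1 - p <= q n.+1 - 2.
  have [ge_p|lt_p] := leqP (q n.+1) p; first lia.
  rewrite leqNgt; apply/negP => gt_l; apply: (bound n.+1 p); first lia.
  by apply: agree_leq ag_p; lia.
(* As [i.+1 > q n + q n.+1 - 2], a short border forces [q n < p]; the occurrence at [q n] is then a
   third one. *)
by apply: (no_i (q n)); [lia | apply: agree_leq (ag n)].
Qed.

(** * Standard words and their limit *)

Lemma size_word_pow (T : Type) (u : seq T) (n : nat) :
  size (word_pow u n) = n * size u.
Proof. by rewrite size_flatten /shape map_nseq sumn_nseq mulnC. Qed.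

Lemma word_powS (T : Type) (u : seq T) (n : nat) :
  word_pow u n.+1 = u ++ word_pow u n.
Proof. by []. Qed.

Lemma std_shiftSS (d : nat -> nat) (n : nat) :
  std_shift d n.+2 = word_pow (std_shift d n.+1) (d n) ++ std_shift d n.
Proof. by []. Qed.

(** Both products for [n.+1] start with the same power of [std_shift d n.+1]; removing it leaves the
    two products for [n] in exchanged order, so [x] and [y] trade places. *)
Lemma std_shift_swap (d : nat -> nat) (n : nat) :
  exists c x y, [/\ x <> y,
    std_shift d n.+1 ++ std_shift d n = c ++ [:: x; y] &
    std_shift d n ++ std_shift d n.+1 = c ++ [:: y; x]].
Proof.
elim: n => [|n [c [x [y [neq eq1 eq2]]]]].
  by exists [::], letter_a, letter_b.
exists (word_pow (std_shift d n.+1) (d n) ++ c), y, x; split.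
- by move/esym.
- by rewrite std_shiftSS -!catA eq2.
- rewrite std_shiftSS -catA -eq1 !catA; congr (_ ++ _).
  by elim: (d n) => [|k IHk]; rewrite ?cats0 // word_powS -catA -IHk.
Qed.

Lemma std_prefixS (d : nat -> nat) (n : nat) : 0 < d n ->
  prefix (std d n) (std d n.+1).
Proof.
move=> d_gt0; rewrite /std std_shiftSS -(prednK d_gt0) word_powS -catA.
exact: prefix_prefix.
Qed.

Lemma std_prefix (d : nat -> nat) (m n : nat) : (forall n, 0 < d n) ->
  m <= n -> prefix (std d m) (std d n).
Proof.
move=> d_gt0 /subnKC <-; elim: (n - m) => [|k IHk]; last first.
  by rewrite addnS; apply: prefix_trans IHk (std_prefixS _).
by rewrite addn0 prefix_refl.
Qed.

(** After the first factor [std d n.+1] comes either [std d n] itself, when [d n.+1 = 1], or another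
    [std d n.+1], which begins with [std d n]. *)
Lemma std_cat_prefix (d : nat -> nat) (n : nat) : (forall n, 0 < d n) ->
  prefix (std d n.+1 ++ std d n) (std d n.+2).
Proof.
move=> d_gt0; rewrite [std d n.+2]std_shiftSS -(prednK (d_gt0 n.+1)) word_powS.
rewrite -catA; case: (d n.+1).-1 => [|k]; first exact: prefix_refl.
rewrite prefix_catr // eqxx word_powS -catA.
apply: prefix_trans (prefix_prefix _ _).
exact: std_prefixS.
Qed.

Lemma prefix_nth (T : eqType) (x0 : T) (u v : seq T) (i : nat) :
  prefix u v -> i < size u -> nth x0 v i = nth x0 u i.
Proof. by case/prefixP => t -> lt_i; rewrite nth_cat lt_i. Qed.

Lemma std_lim_nth (d : nat -> nat) (w : nat -> letter) (x0 : letter)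
    (n i : nat) : (forall n, 0 < d n) -> word_lim (std d) w ->
  i < size (std d n) -> nth x0 (std d n) i = w i.
Proof.
move=> d_gt0 /(_ i)[N w_i] lt_i.
have /(onth_nth x0) <- := w_i (maxn n N) (leq_maxr _ _).
by apply/esym/prefix_nth => //; apply: std_prefix; rewrite ?leq_maxl.
Qed.

(** * Lengths of standard words as continuants *)

Lemma continuant_rcons2 (s : seq nat) (x y : nat) :
  continuant (rcons (rcons s x) y) =
  y * continuant (rcons s x) + continuant s.
Proof. by rewrite /continuant !rev_rcons. Qed.

Lemma size_std (d : nat -> nat) (n : nat) :
  size (std d n) = continuant (1 :: mkseq d n).
Proof.
suff [] : size (std d n) = continuant (1 :: mkseq d n) /\
          size (std d n.+1) = continuant (1 :: mkseq d n.+1) by [].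
elim: n => [|n [IH1 IH2]]; split=> //.
  by rewrite /std std_shiftSS size_cat size_word_pow /continuant /= muln1.
rewrite {1}/std std_shiftSS size_cat size_word_pow.
rewrite [size _]IH2 [size (std_shift d n.+1)]IH1.
by rewrite [mkseq d n.+2]mkseqS mkseqS -!rcons_cons continuant_rcons2.
Qed.

(** Lowering the last entry of a continuant by one subtracts the continuant without that entry. *)
Lemma kseqE (d : nat -> nat) (n : nat) : 0 < d n ->
  kseq d n = size (std d n.+1) - size (std d n).
Proof.
move=> d_gt0; rewrite !size_std mkseqS /kseq.
case: n => [|n] in d_gt0 *; first by rewrite /continuant /=; lia.
rewrite mkseqS -!rcons_cons !continuant_rcons2 mulnBl mul1n.
by rewrite addnBAC // leq_pmull.
Qed.

Lemma size_std_shift_gt0 (d : nat -> nat) (n : nat) : 0 < size (std_shift d n).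
Proof.
suff [] : 0 < size (std_shift d n) /\ 0 < size (std_shift d n.+1) by [].
elim: n => [|n [IH1 IH2]]; split=> //.
by rewrite std_shiftSS size_cat addn_gt0 IH1 orbT.
Qed.

Lemma std_size_lt (d : nat -> nat) (n : nat) : 0 < d n ->
  size (std d n) < size (std d n.+1).
Proof.
move=> d_gt0; rewrite {2}/std std_shiftSS size_cat size_word_pow -/(std d n).
have := leq_pmull (size (std d n)) d_gt0.
by have := size_std_shift_gt0 d n; lia.
Qed.

(** * Shifts of the limit word, and the conclusion *)

Lemma std_lim_shift (d : nat -> nat) (w : nat -> letter) (n : nat) :
  (forall n, 0 < d n) -> word_lim (std d) w ->
  agree w (size (std d n.+1) - 2) (size (std d n)) /\
  w (size (std d n.+1) - 2 + size (std d n)) <> w (size (std d n.+1) - 2).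
Proof.
move=> d_gt0 w_std.
have [c [x [y [neq eq1 eq2]]]] := std_shift_swap d n.+1.
rewrite -!/(std d _) in eq1 eq2.
have size_c : size c + 2 = size (std d n.+1) + size (std d n).
  by rewrite -size_cat eq1 size_cat.
(* Past the first [size (std d n)] letters, [c ++ [:: x; y]] shows the shifted [w], while [c ++
   [:: y; x]] shows [std d n.+1], hence [w] unshifted. *)
have w_r i : i < size (std d n.+1) ->
    w (i + size (std d n)) = nth x (c ++ [:: x; y]) (i + size (std d n)).
  move=> lt_i; have lt_cat : i + size (std d n) < size (std d n.+1 ++ std d n).
    by rewrite size_cat ltn_add2r.
  have pre := std_cat_prefix n d_gt0.
  rewrite -eq1 -(prefix_nth x pre lt_cat).
  apply/esym/(std_lim_nth x d_gt0) => //.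
  exact: leq_trans lt_cat (size_prefix pre).
have w_l i : i < size (std d n.+1) ->
    w i = nth x (c ++ [:: y; x]) (i + size (std d n)).
  move=> lt_i; rewrite -eq2 nth_cat ltnNge leq_addl addnK.
  exact/esym/std_lim_nth.
have size1 : 0 < size (std d n) by apply: size_std_shift_gt0.
have size2 := std_size_lt (d_gt0 n).
split=> [i lt_i|]; first by rewrite w_r ?w_l ?nth_cat; [|lia..]; case: ifP; lia.
rewrite w_r ?w_l; [|lia..].
have -> : size (std d n.+1) - 2 + size (std d n) = size c by lia.
by rewrite !nth_cat ltnn subnn.
Qed.

Theorem corollary20 (R : realType) (alpha : R) (d : nat -> nat)
    (w : nat -> letter) (alpha_irr : irrational alpha)
    (alpha_gt0 : (0 < alpha)%R) (alpha_lt_half : (alpha < 1 / 2)%R)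
    (alpha_cf : is_contfrac (slope_quotients d) alpha) (d0_gt0 : (0 < d 0)%N)
    (w_std : word_lim (std d) w) :
  is_infinite_product (fun n => nseq (kseq d n) 1%N ++ nseq (kseq d n) 0%N)
    (oc w).
Proof.
(* For [n > 0], [d n] is the partial quotient of index [n.+1]. *)
have d_gt0 n : 0 < d n.
  by case: n => // n; have [/(_ n.+2 isT)] := alpha_cf.
have q_lt n := std_size_lt (d_gt0 n).
have size_gt n : n < size (std d n).
  by elim: n => // n IHn; apply: leq_trans (q_lt n).
have oc_pref := oc_mkseq (erefl : size (std d 0) = 1) q_lt
  (fun n => (std_lim_shift n d_gt0 w_std).1)
  (fun n => (std_lim_shift n d_gt0 w_std).2).
(* The first [n] blocks have total length [2 * size (std d n) - 2 >= 2 * n], which exceeds [i] once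
   [n > i]. *)
move=> i; exists i.+1 => n lt_in.
have def_u : (fun n => nseq (kseq d n) 1 ++ nseq (kseq d n) 0)
    =1 (fun n => nseq (size (std d n.+1) - size (std d n)) 1 ++
                 nseq (size (std d n.+1) - size (std d n)) 0).
  by move=> k; rewrite kseqE.
have lt_i : i < 2 * size (std d n) - 2 by have := size_gt n; lia.
by rewrite (eq_mkseq def_u) oc_pref onthE (nth_map 0) ?size_mkseq // nth_mkseq.
Qed.
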